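(* There is an absolute constant $C>0$ such that the following holds. Let $V$ be a finite set with $|V|\ge 2$ and let $\mathcal{P}=(P_t)_{t\ge 1}$ be a sequence of irreducible, reversible and lazy transition matrices on $V$ which all have the same stationary distribution $\pi$. Then for every $0<\epsilon<1$, $$t_{\mathrm{mix}}^{(\infty,\pi)}(\mathcal{P},\epsilon)\le C\left(t_{\mathrm{HIT}}(\mathcal{P})+t_{\mathrm{REL}}(\mathcal{P})\log \epsilon^{-1}\right).$$
   Context: A transition matrix $P\in[0,1]^{V\times V}$ is a row-stochastic matrix. It is irreducible if for all $u,v$ there is $t>0$ with $P^t(u,v)>0$; lazy if $P(v,v)\ge 1/2$ for all $v$; reversible if $\pi(u)P(u,v)=\pi(v)P(v,u)$ for all $u,v$, where $\pi$ is its stationary distribution. $\lambda_\star(P)$ is the second largest eigenvalue of $P$ in absolute value (i.e. the largest absolute value of an eigenvalue after removing one copy of the eigenvalue $1$), and $t_{\mathrm{rel}}(P)=(1-\lambda_\star(P))^{-1}$. $t_{\mathrm{hit}}(P)=\max_{u,w\in V}\mathbf{E}[\min\{t\ge 0:X_t=w\}\mid X_0=u]$, where $(X_t)_{t\ge0}$ is the time-homogeneous Markov chain with transition matrix $P$. $t_{\mathrm{HIT}}(\mathcal{P})=\max_{t\ge 1}t_{\mathrm{hit}}(P_t)$ and $t_{\mathrm{REL}}(\mathcal{P})=\max_{t\ge 1}t_{\mathrm{rel}}(P_t)$ (read as suprema, assumed finite). $t_{\mathrm{mix}}^{(\infty,\pi)}(\mathcal{P},\epsilon)=\min\left\{t\ge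 0:\max_{s\ge 0,\,u,v\in V}\left|\frac{(P_{s+1}P_{s+2}\cdots P_{s+t})(u,v)}{\pi(v)}-1\right|\le\epsilon\right\}$ (the maximum over $s$ is read as a supremum; the empty product is the identity). *)

(* Defs.v *)
From HB Require Import structures.
From mathcomp Require Import all_boot all_order all_algebra.
From mathcomp Require Import complex.
From mathcomp Require Import all_classical all_reals all_analysis.
From mathcomp Require Import measurable_realfun.
Set Implicit Arguments.
Unset Strict Implicit.
Unset Printing Implicit Defensive.
Import Order.TTheory GRing.Theory Num.Theory.
Import numFieldNormedType.Exports.
Local Open Scope classical_set_scope.
Local Open Scope ring_scope.

(* A V x V matrix is an element of 'M[R]_#|V|, its rows and columns being
   indexed by V through enum_rank. *)
Definition entry (R : realType) (V : finType) (P : 'M[R]_#|V|) (u v : V) : R :=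
  P (enum_rank u) (enum_rank v).

Section TransitionMatrices.
Variables (R : realType) (V : finType).
Implicit Types (P : 'M[R]_#|V|) (pi : V -> R) (u v w : V).

Definition transition_matrix P : Prop :=
  (forall u v, 0 <= entry P u v <= 1) /\
  (forall u, \sum_(v : V) entry P u v = 1).

Definition irreducible P : Prop :=
  forall u v, exists2 t : nat, (0 < t)%N & 0 < entry (P ^+ t) u v.

Definition lazy P : Prop := forall v, 1 / 2 <= entry P v v.

Definition stationary P pi : Prop :=
  [/\ forall v, 0 <= pi v,
      \sum_(v : V) pi v = 1 &
      forall v, \sum_(u : V) pi u * entry P u v = pi v].

Definition reversible P pi : Prop :=
  forall u v, pi u * entry P u v = pi v * entry P v u.

(* The n complex eigenvalues of an n x n matrix, listed with their algebraic
   multiplicities. *)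
Definition eigenvalues (n : nat) (A : 'M[R]_n) : seq R[i] :=
  sval (closed_field_poly_normal
          (char_poly (map_mx (real_complex R) A))).

(* rem removes a single occurrence of the eigenvalue 1; the norm of R[i] takes
   its (real) values in R[i], hence the projection to R. *)
Definition lambda_star P : R :=
  \big[Num.max/0]_(z <- rem (1 : R[i]) (eigenvalues P)) complex.Re `|z|.

(* The inverse is the one of the extended reals, in which 0^-1 = +oo. *)
Definition trel P : \bar R := ((1 - lambda_star P)%:E^-1)%E.

Definition path_prob P u (t : nat) (x : {ffun 'I_t.+1 -> V}) : R :=
  (x ord0 == u)%:R *
  \prod_(i < t) entry P (x (inord i)) (x (inord i.+1)).

(* The probability that the chain started from u is at w for the first time
   at time t: the trajectories up to time t which satisfy this are summed. *)
Definition hit_prob P u w (t : nat) : R :=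
  \sum_(x : {ffun 'I_t.+1 -> V} |
        (x ord_max == w) && [forall i : 'I_t, x (inord i) != w])
    path_prob P u x.

(* The mean of the first hitting time of w, which takes the value +oo with
   probability 1 - \sum_t hit_prob P u w t; by convention +oo * 0 = 0. *)
Definition expected_hit P u w : \bar R :=
  (\sum_(0 <= t <oo) (t%:R * hit_prob P u w t)%:E +
   +oo * (1 - \sum_(0 <= t <oo) (hit_prob P u w t)%:E))%E.

Definition thit P : \bar R :=
  \big[maxe/-oo%E]_(u : V) \big[maxe/-oo%E]_(w : V) expected_hit P u w.

End TransitionMatrices.

(* X is a Markov chain with transition matrix P started from u: its
   finite-dimensional distributions are those of path_prob. *)
Definition markov_chain (R : realType) (V : finType) (P : 'M[R]_#|V|) (u : V)
    (d : measure_display) (T : measurableType d) (Pr : probability T R)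
    (X : nat -> T -> V) : Prop :=
  (forall t v, measurable (X t @^-1` [set v])) /\
  (forall (t : nat) (x : {ffun 'I_t.+1 -> V}),
     Pr [set om | forall i : 'I_t.+1, X i om = x i] = (path_prob P u x)%:E).

Definition hitting_time (R : realType) (V : finType) (T : Type)
    (X : nat -> T -> V) (w : V) (om : T) : \bar R :=
  ereal_inf [set t%:R%:E | t in [set t : nat | X t om = w]].

(* expected_hit P u w is E[min {t >= 0 : X_t = w} | X_0 = u] for any realization
   X of the chain on a probability space. *)
Lemma expected_hitE (R : realType) (V : finType) (P : 'M[R]_#|V|) (u w : V)
    (d : measure_display) (T : measurableType d) (Pr : probability T R)
    (X : nat -> T -> V) :
  markov_chain P u Pr X ->
  (\int[Pr]_om hitting_time R X w om)%E = expected_hit P u w.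
Proof.
move=> [mX XP].
pose A t := [set om | X t om = w /\ forall s, (s < t)%N -> X s om <> w].
have mA t : measurable (A t).
  have -> : A t = X t @^-1` [set w] `&`
      \bigcap_(s in [set s | (s < t)%N]) ~` (X s @^-1` [set w]).
    by apply/seteqP; split=> om /= [].
  apply: measurableI => //; apply: bigcap_measurableType => s _.
  exact: measurableC.
have trivA : trivIset setT A.
  apply/trivIsetP => i j _ _; rewrite neq_ltn => /orP[] ij;
  apply/seteqP; split=> om //= [[Xi Hi] [Xj Hj]].
    exact: (Hj _ ij).
  exact: (Hi _ ij).
have PrA t : Pr (A t) = (hit_prob P u w t)%:E.
  pose D := [set` [pred x : {ffun 'I_t.+1 -> V} |
     (x ord_max == w) && [forall i : 'I_t, x (inord i) != w]]].
  pose F (x : {ffun 'I_t.+1 -> V}) :=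
     [set om | forall i : 'I_t.+1, X i om = x i].
  have -> : A t = \bigcup_(x in D) F x.
    apply/seteqP; split=> om /=.
      move=> [Xt Hs]; exists [ffun i : 'I_t.+1 => X i om]; last first.
        by move=> i /=; rewrite ffunE.
      rewrite /D /= inE ffunE /= Xt eqxx /=; apply/forallP => i.
      rewrite ffunE inordK; first exact/eqP/Hs.
      by rewrite ltnS ltnW.
    move=> [x]; rewrite /D /= inE => /andP[/eqP xt /forallP xs] Xx; split.
      by rewrite -xt -Xx.
    move=> s st; apply/eqP; have := xs (Ordinal st).
    by rewrite -Xx /= inordK// ltnS ltnW.
  rewrite measure_fin_bigcup; first last.
  - move=> x _; have -> : F x = \bigcap_(i in setT) (X i @^-1` [set x (inord i)] `|` [set om | (t < i)%N]).
      apply/seteqP; split=> om /=.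
        move=> Fx i _ /=; case: (leqP i t) => it; [left|by right].
        by rewrite -Fx inordK.
      move=> H i; case: (H i I) => /=; first by rewrite inord_val.
      by rewrite ltnNge -ltnS ltn_ord.
    apply: bigcap_measurableType => i _; apply: measurableU => //.
    case: (ltnP t i) => _; first by rewrite (_ : [set _ | _] = setT)//; apply/seteqP; split.
    by rewrite (_ : [set _ | _] = set0)//; apply/seteqP; split.
  - apply/trivIsetP => x y _ _ /eqP xy; apply/seteqP; split=> om //= [Hx Hy].
    by apply: xy; apply/ffunP => i; rewrite -Hx -Hy.
  - exact: finite_finset.
  rewrite -(@bigfs _ _ _ _ (index_enum _)) ?index_enum_uniq//; last first.
    by move=> x _; rewrite mem_index_enum.
  by rewrite /hit_prob -sumEFin; apply: eq_bigr => x _; exact: XP.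
pose tau : T -> \bar R := hitting_time R X w.
have tauA t om : A t om -> tau om = t%:R%:E.
  move=> [Xt Hs]; apply/eqP; rewrite eq_le; apply/andP; split.
    by apply: ereal_inf_lbound; exists t.
  apply: le_ereal_inf_tmp => _ [s /= Xs <-]; rewrite lee_fin ler_nat leqNgt.
  by apply/negP => /Hs; apply.
have tauN om : ~ (\bigcup_t A t) om -> tau om = +oo%E.
  move=> nA; apply/ereal_inf_pinfty => _ [s /= Xs <-]; exfalso; apply: nA.
  have ex : exists s, X s om == w by exists s; apply/eqP.
  exists (ex_minn ex) => //; case: ex_minnP => m /eqP Xm Hm; split=> // k km.
  by move/eqP/Hm; rewrite leqNgt km.
have mU : measurable (\bigcup_t A t) by exact: bigcup_measurable.
have mtauA t : measurable_fun (A t) (tau : T -> \bar R).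
  apply: (@eq_measurable_fun _ _ _ _ _ (cst t%:R%:E)) => // om.
  by rewrite inE => /tauA ->.
have mtauU : measurable_fun (\bigcup_t A t) (tau : T -> \bar R) by apply/measurable_fun_bigcup.
have mtauN : measurable_fun (~` \bigcup_t A t) (tau : T -> \bar R).
  apply: (@eq_measurable_fun _ _ _ _ _ (cst +oo%E)) => // om.
  by rewrite inE => /tauN ->.
have tau0 om : (0 <= tau om)%E.
  by apply: le_ereal_inf_tmp => _ [s /= _ <-]; rewrite lee_fin.
rewrite -(setUv (\bigcup_t A t)) ge0_integral_setU//; first last.
- exact/disj_set2P/setICr.
- by apply/measurable_funU => //; exact: measurableC.
- exact: measurableC.
rewrite ge0_integral_bigcup//; congr (_ + _)%E.
  apply: eq_eseriesr => t _.
  transitivity (\int[Pr]_(x in A t) cst (t%:R%:E : \bar R) x)%E.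
    by apply: eq_integral => om; rewrite inE => /tauA.
  by rewrite integral_cst// EFinM; congr (_ * _)%E; exact: PrA.
transitivity (\int[Pr]_(x in ~` \bigcup_t A t) cst (+oo%E : \bar R) x)%E.
  by apply: eq_integral => om; rewrite inE => /tauN.
rewrite integral_cst; last exact: measurableC.
congr (_ * _)%E; transitivity (1 - Pr (\bigcup_t A t))%E.
  exact: probability_setC.
congr (_ - _)%E; transitivity (\sum_(0 <= t <oo) Pr (A t))%E.
  exact: measure_semi_bigcup.
by apply: eq_eseriesr => t _; exact: PrA.
Qed.

(* A sequence (P_t)_{t >= 1} is given by P : nat -> 'M[R]_#|V|; the value P 0
   is never used. *)
Section TimeInhomogeneous.
Variables (R : realType) (V : finType).
Implicit Types (P : nat -> 'M[R]_#|V|) (pi : V -> R).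

Definition tHIT P : \bar R := ereal_sup [set thit (P t) | t in [set t | (1 <= t)%N]].

Definition tREL P : \bar R := ereal_sup [set trel (P t) | t in [set t | (1 <= t)%N]].

(* P_{s+1} P_{s+2} ... P_{s+t} *)
Definition transition_prod P (s t : nat) : 'M[R]_#|V| :=
  \prod_(s.+1 <= i < (s + t).+1) P i.

Definition dist_inf P pi (t : nat) : \bar R :=
  ereal_sup [set e | exists s : nat, exists u : V, exists v : V,
    e = (`| entry (transition_prod P s t) u v / pi v - 1 |)%:E].

(* Equals +oo when no t qualifies. *)
Definition tmix_inf P pi (eps : R) : \bar R :=
  ereal_inf [set t%:R%:E | t in [set t : nat | (dist_inf P pi t <= eps%:E)%E]].

End TimeInhomogeneous.

(* Main.v *)
Require Import Defs.
From HB Require Import structures.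
From mathcomp Require Import all_boot all_order all_algebra.
From mathcomp Require Import complex.
From mathcomp Require Import all_classical all_reals all_analysis.
From mathcomp Require Import ring lra.
Set Implicit Arguments.
Unset Strict Implicit.
Unset Printing Implicit Defensive.
Import Order.TTheory GRing.Theory Num.Theory.
Local Open Scope ring_scope.

(* Work in L^2(pi), with the Dirichlet form E(f,g) = <(I - P) f, g>.  The mean
   hitting times h of a state w satisfy (I - P) h = 1 - delta_w / pi(w), so that
   E(h,f) = mean f - f(w) and E(h,h) = mean h <= t_hit; Cauchy-Schwarz for E
   gives (f(w) - mean f)^2 <= t_hit E(f,f).  For a density f this yields the
   Nash-type inequality Var(f)^2 <= t_hit E(f,f), and laziness gives
   Var(Pf) <= Var(f) - E(f,f), whence Var <= t_HIT / t after t steps, whatever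
   the matrices.  A product of 2a + b matrices with a >= t_HIT is read as the
   inner product of the densities obtained from delta_u / pi(u) by the first a
   steps reversed and from delta_v / pi(v) by the last a steps, both of variance
   at most 1, with the b middle steps in between; on functions of mean 0 these
   contract by 1 - 1 / t_REL each. *)

(** * Reversible operators and Dirichlet forms on functions weighted by [pi] *)

Section WeightedSpace.
Context {R : realType} {V : finType} (pi : V -> R).
Implicit Types (f g h : V -> R) (P : 'M[R]_#|V|).

Definition mean f := \sum_v pi v * f v.
Definition ip f g := mean (fun v => f v * g v).

Lemma ipC f g : ip f g = ip g f.
Proof. by apply: eq_bigr => v _; rewrite [f v * _]mulrC. Qed.

Lemma ipDl f g h (a b : R) :
  ip (fun v => a * f v + b * g v) h = a * ip f h + b * ip g h.
Proof.
rewrite /ip /mean !mulr_sumr -big_split; apply: eq_bigr => v _ /=; ring.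
Qed.

Lemma ipDr f g h (a b : R) :
  ip h (fun v => a * f v + b * g v) = a * ip h f + b * ip h g.
Proof. by rewrite ipC ipDl !(ipC _ h). Qed.

Lemma ip_ge0 f : (forall v, 0 <= pi v) -> 0 <= ip f f.
Proof. by move=> pi0; apply: sumr_ge0 => v _; rewrite mulr_ge0// -expr2 sqr_ge0. Qed.

Lemma ip1r f : ip f (fun=> 1) = mean f.
Proof. by apply: eq_bigr => v _; rewrite mulr1. Qed.

Lemma mean1 : \sum_v pi v = 1 -> mean (fun=> 1) = 1.
Proof. by move=> pi1; rewrite -[RHS]pi1; apply: eq_bigr => v _; rewrite mulr1. Qed.

Lemma ip_center f g : \sum_v pi v = 1 ->
  ip (fun v => f v - mean f) (fun v => g v - mean g) = ip f g - mean f * mean g.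
Proof.
move=> pi1.
have -> : (fun v => f v - mean f) = (fun v => 1 * f v + - mean f * 1).
  by apply/funext => v; ring.
have -> : (fun v => g v - mean g) = (fun v => 1 * g v + - mean g * 1).
  by apply/funext => v; ring.
by rewrite ipDl !ipDr ip1r [ip (fun=> 1) g]ipC !ip1r mean1//; ring.
Qed.

Definition mxact P f : V -> R := fun u => \sum_v entry P u v * f v.

Lemma opD P f g (a b : R) :
  mxact P (fun v => a * f v + b * g v) = (fun v => a * mxact P f v + b * mxact P g v).
Proof.
apply/funext => u; rewrite /mxact !mulr_sumr -big_split.
by apply: eq_bigr => v _ /=; ring.
Qed.

Lemma entry_mul (A B : 'M[R]_#|V|) u v :
  entry (A * B) u v = \sum_w entry A u w * entry B w v.
Proof.
rewrite /entry -[A * B]/(A *m B) mxE.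
rewrite (reindex (@enum_rank V)) //; exists enum_val => i _.
  exact: enum_rankK.
exact: enum_valK.
Qed.

Lemma entry1 u v : entry (1 : 'M[R]_#|V|) u v = (u == v)%:R.
Proof. by rewrite /entry mxE (inj_eq enum_rank_inj). Qed.

Lemma op_mul (A B : 'M[R]_#|V|) f : mxact (A * B) f = mxact A (mxact B f).
Proof.
apply/funext => u; rewrite /mxact.
under eq_bigr do rewrite entry_mul mulr_suml.
rewrite exchange_big; apply: eq_bigr => w _.
by rewrite mulr_sumr; apply: eq_bigr => v _; rewrite mulrA.
Qed.

Lemma op1 f : mxact 1 f = f.
Proof.
apply/funext => u; rewrite /mxact (bigD1 u)//= big1 ?addr0.
  by rewrite entry1 eqxx mul1r.
by move=> v vu; rewrite entry1 eq_sym (negbTE vu) mul0r.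
Qed.

Lemma op_self_adjoint P f g : reversible P pi -> ip (mxact P f) g = ip f (mxact P g).
Proof.
move=> rev; transitivity (\sum_u \sum_v (pi u * entry P u v) * (f v * g u)).
  apply: eq_bigr => u _; rewrite /mxact mulr_suml mulr_sumr.
  by apply: eq_bigr => v _; ring.
rewrite exchange_big; apply: eq_bigr => u _; rewrite /mxact !mulr_sumr.
by apply: eq_bigr => v _; rewrite rev; ring.
Qed.

Lemma op_cst P : transition_matrix P -> mxact P (fun=> 1) = (fun=> 1).
Proof.
move=> [_ P1]; apply/funext => u; rewrite -[RHS](P1 u).
by apply: eq_bigr => v _; rewrite mulr1.
Qed.

Lemma op_center P f (a : R) : transition_matrix P ->
  mxact P (fun v => f v - a) = (fun v => mxact P f v - a).
Proof.
move=> tP; transitivity (mxact P (fun v => 1 * f v + - a * 1)).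
  by congr mxact; apply/funext => v; ring.
by rewrite opD op_cst//; apply/funext => v; ring.
Qed.

Lemma mean_op P f : transition_matrix P -> reversible P pi ->
  mean (mxact P f) = mean f.
Proof. by move=> tP rP; rewrite -ip1r op_self_adjoint// op_cst// ip1r. Qed.

Lemma op_ge0 P f : transition_matrix P -> (forall v, 0 <= f v) ->
  forall v, 0 <= mxact P f v.
Proof.
move=> [P01 _] f0 v; apply: sumr_ge0 => u _; rewrite mulr_ge0//.
by have /andP[] := P01 v u.
Qed.

Definition dirichlet P f g := ip f g - ip (mxact P f) g.

Lemma dirichletC P f g : reversible P pi -> dirichlet P f g = dirichlet P g f.
Proof. by move=> rP; rewrite /dirichlet op_self_adjoint// ipC [ip f (mxact _ _)]ipC. Qed.

Lemma dirichletDl P f g h (a b : R) :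
  dirichlet P (fun v => a * f v + b * g v) h = a * dirichlet P f h + b * dirichlet P g h.
Proof. rewrite /dirichlet opD !ipDl; ring. Qed.

Lemma row_jensen (q f : V -> R) : (forall v, 0 <= q v) -> \sum_v q v = 1 ->
  (\sum_v q v * f v) ^+ 2 <= \sum_v q v * f v ^+ 2.
Proof.
move=> q0 q1; move mE: (\sum_v q v * f v) => m.
have : 0 <= \sum_v q v * (f v - m) ^+ 2.
  by apply: sumr_ge0 => v _; rewrite mulr_ge0// sqr_ge0.
have -> : \sum_v q v * (f v - m) ^+ 2 = \sum_v q v * f v ^+ 2 - m ^+ 2; last by rewrite subr_ge0.
transitivity (\sum_v q v * f v ^+ 2 - (\sum_v q v * f v) * (2 * m) + m ^+ 2 * \sum_v q v).
  by rewrite mulr_suml mulr_sumr -sumrB -big_split; apply: eq_bigr => v _ /=; ring.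
by rewrite q1 mE; ring.
Qed.

(** Jensen in each row, then reversibility turns the row weights into column weights. The kernel [q]
    is a plain function so that the bound serves both [P] and [2P - I]. *)
Lemma ip_contraction (q : V -> V -> R) f : (forall v, 0 <= pi v) ->
  (forall u v, 0 <= q u v) -> (forall u, \sum_v q u v = 1) ->
  (forall u v, pi u * q u v = pi v * q v u) ->
  ip (fun u => \sum_v q u v * f v) (fun u => \sum_v q u v * f v) <= ip f f.
Proof.
move=> pi0 q0 q1 rq.
apply: (@le_trans _ _ (\sum_u \sum_v pi u * q u v * f v ^+ 2)).
  apply: ler_sum => u _; rewrite -expr2.
  under [leRHS]eq_bigr do rewrite -mulrA.
  by rewrite -mulr_sumr ler_wpM2l// row_jensen.
rewrite exchange_big; apply: ler_sum => u _ /=.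
under eq_bigr do rewrite rq.
by rewrite -mulr_suml -mulr_sumr q1 mulr1 expr2.
Qed.

(** Expanding [|f - Pf|^2 >= 0] and bounding [|Pf|^2] by [|f|^2] leaves twice the Dirichlet form. *)
Lemma dirichlet_ge0 P f : (forall v, 0 <= pi v) -> transition_matrix P ->
  reversible P pi -> 0 <= dirichlet P f f.
Proof.
move=> pi0 [P01 P1] rP.
have c : ip (mxact P f) (mxact P f) <= ip f f.
  by apply: ip_contraction => // u v; have /andP[] := P01 u v.
have := ip_ge0 (fun v => 1 * f v + -1 * mxact P f v) pi0.
rewrite ipDl !ipDr [ip f (mxact P f)]ipC /dirichlet; lra.
Qed.

(* For lazy P the matrix Q = 2P - I is again stochastic and reversible, and
   |Qf| <= |f| unfolds to |Pf|^2 <= <Pf, f>. *)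
Lemma lazy_dirichlet P f : (forall v, 0 <= pi v) -> transition_matrix P ->
  reversible P pi -> lazy P ->
  ip (mxact P f) (mxact P f) <= ip f f - dirichlet P f f.
Proof.
move=> pi0 [P01 P1] rP lP.
pose q u v := 2 * entry P u v - (u == v)%:R.
have qf u : \sum_v q u v * f v = 2 * mxact P f u + -1 * f u.
  rewrite /q /mxact; under eq_bigr do rewrite mulrBl.
  rewrite sumrB mulr_sumr; congr (_ + _).
    by apply: eq_bigr => v _; rewrite mulrA.
  rewrite (bigD1 u)//= eqxx mulr1n big1; first by ring.
  by move=> v vu; rewrite eq_sym (negbTE vu) mul0r.
have := @ip_contraction q f pi0.
under [X in ip X]funext do rewrite qf.
under [X in ip _ X]funext do rewrite qf.
rewrite ipDl !ipDr [ip f (mxact P f)]ipC /dirichlet => H.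
suff: 2 * (2 * ip (mxact P f) (mxact P f) + -1 * ip (mxact P f) f) +
   -1 * (2 * ip (mxact P f) f + -1 * ip f f) <= ip f f by lra.
apply: H => [u v|u|u v].
- rewrite /q; case: eqVneq => [->|_]; first by rewrite mulr1n; have := lP v; lra.
  by rewrite subr0 mulr_ge0//; have /andP[] := P01 u v.
- transitivity (\sum_v q u v * 1); first by apply: eq_bigr => v _; rewrite mulr1.
  rewrite /q; under eq_bigr do rewrite mulr1.
  rewrite sumrB -mulr_sumr P1 (bigD1 u)//= eqxx mulr1n big1; first by ring.
  by move=> v vu; rewrite eq_sym (negbTE vu).
- rewrite /q !mulrBr eq_sym; congr (_ - _).
    by rewrite !(mulrCA _ 2) rP.
  by case: eqVneq => [->//|]; rewrite !mulr0.
Qed.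

(* Expanding dirichlet P (f + a h) (f + a h) >= 0 with a = (f w - mean f) / H. *)
Lemma pointwise_dirichlet P f h w (H : R) : (forall v, 0 <= pi v) ->
  transition_matrix P -> reversible P pi -> 0 < H ->
  dirichlet P h h <= H ->
  dirichlet P h f = mean f - f w ->
  (f w - mean f) ^+ 2 <= H * dirichlet P f f.
Proof.
move=> pi0 tP rP H0 hH hf; set a := (f w - mean f) / H.
have := dirichlet_ge0 (fun v => 1 * f v + a * h v) pi0 tP rP.
rewrite dirichletDl [dirichlet P f _]dirichletC// [dirichlet P h _]dirichletC//.
rewrite !dirichletDl (dirichletC f h rP) hf => p.
have aH : a * H = f w - mean f by rewrite /a mulfVK// gt_eqF.
have {}p : 0 <= dirichlet P f f + 2 * a * (mean f - f w) + a ^+ 2 * H.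
  by have : 0 <= a ^+ 2 * (H - dirichlet P h h); [rewrite mulr_ge0 ?sqr_ge0// subr_ge0|]; lra.
rewrite -aH.
have : 0 <= H * (dirichlet P f f + 2 * a * (mean f - f w) + a ^+ 2 * H).
  by rewrite mulr_ge0// ltW.
rewrite (_ : mean f - f w = - (a * H)); last by rewrite aH; ring.
lra.
Qed.

(** For a density, the variance is the average of [f - 1] under the probability weights
    [pi v * f v], hence at most the largest value of [f - 1], which the pointwise hypothesis bounds
    by a square root. *)
Lemma variance_dirichlet P f (H : R) : (forall v, 0 <= pi v) ->
  \sum_v pi v = 1 -> (forall v, 0 <= f v) -> mean f = 1 ->
  (forall w, (f w - mean f) ^+ 2 <= H * dirichlet P f f) ->
  (ip f f - 1) ^+ 2 <= H * dirichlet P f f.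
Proof.
move=> pi0 pi1 f0 f1 fH.
have s0 : 0 <= H * dirichlet P f f.
  have [w _|none] := pickP (@predT V).
    by apply: le_trans (fH w); rewrite sqr_ge0.
  have : \sum_v pi v = 0 by rewrite big1// => v; have := none v.
  by rewrite pi1 => /eqP; rewrite oner_eq0.
set s := Num.sqrt (H * dirichlet P f f).
have fs w : f w - 1 <= s.
  apply: le_trans (ler_norm _) _; rewrite -sqrtr_sqr ler_sqrt// -f1; exact: fH.
have V0 : 0 <= ip f f - 1.
  have := ip_ge0 (fun v => f v - mean f) pi0.
  by rewrite ip_center// f1 mulr1.
have Vs : ip f f - 1 <= s.
  rewrite -f1 /ip /mean -sumrB.
  apply: (@le_trans _ _ (\sum_v pi v * f v * s)); last first.
    by rewrite -mulr_suml -/(mean f) f1 mul1r.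
  apply: ler_sum => v _; rewrite mulrA -{2}[pi v * f v]mulr1 -mulrBr.
  by rewrite ler_wpM2l ?mulr_ge0.
by rewrite -[leRHS]sqr_sqrtr// -/s ler_pXn2r// nnegrE sqrtr_ge0.
Qed.

End WeightedSpace.

(** * First-step analysis of hitting times *)

Section HittingTimes.
Context {R : realType} {V : finType} (P : 'M[R]_#|V|).
Implicit Types (u v w : V).

Lemma hit_prob0 u w : hit_prob P u w 0 = (u == w)%:R.
Proof.
rewrite /hit_prob /path_prob.
transitivity (\sum_(x : {ffun 'I_1 -> V} | x == [ffun=> w]) (u == w)%:R  : R);
  last by rewrite big_pred1_eq.
apply: eq_big => x.
  apply/andP/eqP => [[/eqP xw _]|->].
    by apply/ffunP => i; rewrite ffunE -xw; congr (x _); apply/val_inj; case: i => [[]].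
  by rewrite ffunE eqxx; split=> //; apply/forallP => -[].
move=> /andP[/eqP xw _]; rewrite big_ord0 mulr1.
by rewrite (_ : ord0 = ord_max) ?xw 1?eq_sym//; exact/val_inj.
Qed.

Lemma hit_probS_self w t : hit_prob P w w t.+1 = 0.
Proof.
apply: big1 => x /andP[_ /forallP /(_ ord0)].
rewrite /path_prob (_ : inord _ = ord0); last by apply/val_inj; rewrite /= inordK.
by move=> /negbTE ->; rewrite mul0r.
Qed.

(* Decompose the trajectories according to their second point. *)
Lemma hit_probS u w t : u != w ->
  hit_prob P u w t.+1 = \sum_v entry P u v * hit_prob P v w t.
Proof.
move=> uw.
(* [tl] drops the starting point and [cs] puts [u] in front; they are inverse to each other on
   trajectories starting at [u], outside which [path_prob] vanishes. *)
pose tl (x : {ffun 'I_t.+2 -> V}) : {ffun 'I_t.+1 -> V} := [ffun i => x (lift ord0 i)].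
pose cs (y : {ffun 'I_t.+1 -> V}) : {ffun 'I_t.+2 -> V} :=
  [ffun i => if unlift ord0 i is Some j then y j else u].
have tlcs y : tl (cs y) = y by apply/ffunP => i; rewrite !ffunE liftK.
have cstl (x : {ffun 'I_t.+2 -> V}) : x ord0 = u -> cs (tl x) = x.
  move=> x0; apply/ffunP => i; rewrite !ffunE; case: unliftP => [j ->|->//].
  by rewrite ffunE.
have liftin (i : nat) : (i < t.+1)%N -> lift ord0 (inord i : 'I_t.+1) = inord i.+1 :> 'I_t.+2.
  by move=> it; apply/val_inj; rewrite /= /bump /= add1n !inordK.
rewrite /hit_prob (bigID (fun x : {ffun 'I_t.+2 -> V} => x ord0 == u)) /=.
rewrite [X in _ + X]big1 ?addr0; last first.
  by move=> x /andP[_ /negbTE xu]; rewrite /path_prob xu mul0r.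
rewrite (reindex_onto cs tl); last by move=> x /andP[_ /eqP]; exact: cstl.
under [RHS]eq_bigr do rewrite mulr_sumr.
rewrite exchange_big /=.
apply: eq_big => y.
  rewrite tlcs eqxx andbT.
  have -> : cs y ord0 = u by rewrite ffunE unlift_none.
  rewrite eqxx andbT.
  have -> : cs y ord_max = y ord_max.
    by rewrite ffunE (_ : ord_max = lift ord0 ord_max) ?liftK//; exact/val_inj.
  congr (_ && _); apply/forallP/forallP => H i.
    have := H (lift ord0 i); rewrite /= /bump /= add1n -liftin ?ffunE ?liftK//.
    by rewrite ltnS ltnW.
  case: (unliftP ord0 i) => [j ->|->].
    rewrite /= /bump /= add1n -liftin; last by rewrite ltnS ltnW.
    by rewrite ffunE liftK.
  by rewrite (_ : inord _ = ord0) ?ffunE ?unlift_none//; apply/val_inj; rewrite /= inordK.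
move=> _; rewrite /path_prob.
have -> : cs y ord0 = u by rewrite ffunE unlift_none.
rewrite eqxx mul1r big_ord_recl.
rewrite [RHS](bigD1 (y ord0))//= eqxx [X in _ = _ + X]big1; last first.
  by move=> v vy; rewrite eq_sym (negbTE vy) mul0r mulr0.
rewrite mul1r addr0; congr (_ * _).
  rewrite (_ : inord 0 = ord0); last by apply/val_inj; rewrite /= inordK.
  rewrite ffunE unlift_none -liftin// ffunE liftK (_ : inord 0 = ord0)//.
  by apply/val_inj; rewrite /= inordK.
apply: eq_bigr => i _; rewrite /bump /= add1n -!liftin ?ltnS//; last exact: ltnW.
by rewrite !ffunE !liftK.
Qed.

Lemma path_prob_ge0 u t (x : {ffun 'I_t.+1 -> V}) : transition_matrix P ->
  0 <= path_prob P u x.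
Proof.
move=> [P01 _]; rewrite mulr_ge0//; apply: prodr_ge0 => i _.
by have /andP[] := P01 (x (inord i)) (x (inord i.+1)).
Qed.

Lemma hit_prob_ge0 u w t : transition_matrix P -> 0 <= hit_prob P u w t.
Proof. by move=> tP; apply: sumr_ge0 => x _; exact: path_prob_ge0. Qed.

(** Induction on the horizon: one step from [u] gives an average, over a row of [P], of the same
    partial sums with one term less. *)
Lemma sum_hit_prob_le1 u w n : transition_matrix P ->
  \sum_(0 <= t < n) hit_prob P u w t <= 1.
Proof.
move=> tP; elim: n u => [|n IH] u; first by rewrite big_nil.
rewrite big_nat_recl// hit_prob0; case: eqVneq => [->|uw].
  by rewrite big1 ?addr0// => t _; exact: hit_probS_self.
rewrite add0r; under eq_bigr do rewrite hit_probS//.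
rewrite exchange_big /= -(tP.2 u); apply: ler_sum => v _.
rewrite -mulr_sumr -[leRHS]mulr1 ler_wpM2l//.
by have /andP[] := tP.1 u v.
Qed.

Local Open Scope ereal_scope.

(** The probability that [w] is ever reached; [hit_moment] is the part of the mean carried by finite
    hitting times. *)
Definition hit_total u w : \bar R := \sum_(0 <= t <oo) (hit_prob P u w t)%:E.
Definition hit_moment u w : \bar R := \sum_(0 <= t <oo) (t%:R * hit_prob P u w t)%:E.

Lemma hit_total_le1 u w : transition_matrix P -> hit_total u w <= 1.
Proof.
move=> tP; apply: lime_le.
  by apply: is_cvg_nneseries => n _ _; rewrite lee_fin hit_prob_ge0.
by apply: nearW => n; rewrite sumEFin lee_fin sum_hit_prob_le1.
Qed.

Lemma hit_moment_ge0 u w : transition_matrix P -> 0 <= hit_moment u w.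
Proof.
by move=> tP; apply: nneseries_ge0 => n _ _; rewrite lee_fin mulr_ge0// hit_prob_ge0.
Qed.

(** Were [w] missed with positive probability, the [+oo] summand of the mean would survive. *)
Lemma expected_hit_fin u w : transition_matrix P -> expected_hit P u w < +oo ->
  hit_total u w = 1 /\ expected_hit P u w = hit_moment u w.
Proof.
move=> tP; rewrite /expected_hit -/(hit_total u w) -/(hit_moment u w) => fin.
suff S1 : hit_total u w = 1 by split=> //; rewrite S1 subee// mule0 adde0.
apply/eqP; rewrite eq_le hit_total_le1//= leNgt; apply/negP => lt1.
move: fin; rewrite gt0_mulye ?sube_gt0// addey ?ltxx//.
by rewrite gt_eqF// (lt_le_trans _ (hit_moment_ge0 u w tP)).
Qed.

(** After the first step the time splits as [t + 1]: the [t] part sums to the moment from the new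
    state, and the extra unit to the total probability. *)
Lemma hit_moment_rec u w : transition_matrix P -> u != w ->
  hit_moment u w = \sum_v (entry P u v)%:E * (hit_moment v w + hit_total v w).
Proof.
move=> tP uw; rewrite /hit_moment nneseries_recl//; last first.
  by move=> n _; rewrite lee_fin mulr_ge0// hit_prob_ge0.
rewrite mul0r add0e -(nneseries_addn 1); last first.
  by move=> n; rewrite lee_fin mulr_ge0// hit_prob_ge0.
transitivity (\sum_(0 <= t <oo) \sum_v (entry P u v)%:E *
    ((t%:R * hit_prob P v w t)%:E + (hit_prob P v w t)%:E)).
  apply: eq_eseriesr => t _.
  rewrite addn1 hit_probS// mulr_sumr -sumEFin; apply: eq_bigr => v _.
  by rewrite -EFinD -EFinM; congr EFin; rewrite -natr1; ring.
have e0 v : (0 <= entry P u v)%R by have /andP[] := tP.1 u v.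
have s0 v t : 0 <= (t%:R * hit_prob P v w t)%:E + (hit_prob P v w t)%:E.
  by rewrite -EFinD lee_fin addr_ge0// ?mulr_ge0// hit_prob_ge0.
rewrite nneseries_sum; last by move=> v t _; rewrite mule_ge0// lee_fin.
apply: eq_bigr => v _; rewrite nneseriesZl//; congr (_ * _).
rewrite nneseriesD// => t _ _; rewrite lee_fin ?mulr_ge0// hit_prob_ge0//.
Qed.

Lemma hit_momentww w : hit_moment w w = 0.
Proof.
apply: eseries0 => -[|t] _ _; first by rewrite mul0r.
by rewrite hit_probS_self mulr0.
Qed.

(** Termwise [p_t <= t * p_t], including at [t = 0], where distinct states force [p_0 = 0]. *)
Lemma hit_moment_ge1 u w : transition_matrix P -> u != w -> hit_total u w = 1 ->
  1 <= hit_moment u w.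
Proof.
move=> tP uw <-; apply: lee_nneseries => [t _ _|[|t] _].
- by rewrite lee_fin hit_prob_ge0.
- by rewrite hit_prob0 (negbTE uw) mulr0.
- by rewrite lee_fin ler_peMl ?hit_prob_ge0// ler1n.
Qed.

Lemma expected_hit_thit u w : expected_hit P u w <= thit P.
Proof.
rewrite /thit (bigD1 u)//= le_max; apply/orP; left.
by rewrite (bigD1 w)//= le_max lexx.
Qed.

End HittingTimes.

(** * Decay of the variance at a rate set by hitting times *)

Section Decay.
Context {R : realType} {V : finType} (pi : V -> R).
Implicit Types (P : 'M[R]_#|V|) (f g : V -> R) (l : seq 'M[R]_#|V|).

(** The mean hitting times of [w], real because [thit P] is finite, serve as the test function [h]
    of [pointwise_dirichlet]. *)
Lemma hitting_pointwise_dirichlet P f w (H : R) : stationary P pi ->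
  transition_matrix P -> reversible P pi -> 0 < H -> (thit P <= H%:E)%E ->
  (f w - mean pi f) ^+ 2 <= H * dirichlet pi P f f.
Proof.
move=> [pi0 pi1 _] tP rP H0 hH.
have hH' u : (expected_hit P u w <= H%:E)%E.
  exact: le_trans (expected_hit_thit P u w) hH.
have fin u := expected_hit_fin tP (le_lt_trans (hH' u) (ltry _)).
pose h v := fine (hit_moment P v w).
have hE v : hit_moment P v w = (h v)%:E.
  rewrite /h fineK// ge0_fin_numE ?hit_moment_ge0//.
  by rewrite -(fin v).2 (le_lt_trans (hH' v))// ltry.
have hleH v : h v <= H by rewrite -lee_fin -hE -(fin v).2.
have hw : h w = 0 by rewrite /h hit_momentww.
have hrec u : u != w -> h u - mxact P h u = 1.
  move=> uw; have := hit_moment_rec tP uw; rewrite hE.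
  under eq_bigr do rewrite hE (fin _).1 -EFinD -EFinM.
  rewrite sumEFin => -[->]; under eq_bigr do rewrite mulrDr mulr1.
  by rewrite big_split /= tP.2 /mxact; ring.
have dE g : dirichlet pi P h g = \sum_(v | v != w) pi v * g v - pi w * mxact P h w * g w.
  rewrite /dirichlet /ip /mean -sumrB (bigD1 w)//= hw addrC; congr (_ + _).
    by apply: eq_bigr => v vw; rewrite -mulrBr -mulrBl hrec// mul1r.
  by ring.
have mw g : mean pi g = \sum_(v | v != w) pi v * g v + pi w * g w.
  by rewrite /mean (bigD1 w)//= addrC.
(* First-step analysis is silent at [w] itself. Testing against the constant 1 fixes the missing
   value: [pi w * (1 + mxact P h w) = 1], which is Kac's formula for the mean return time. *)
have hm g : dirichlet pi P h g = mean pi g - g w.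
  have : dirichlet pi P h (fun=> 1) = 0.
    by rewrite /dirichlet !ip1r mean_op// subrr.
  rewrite dE => e; have := mean1 pi1; rewrite mw => e1.
  by rewrite dE mw (_ : pi w * mxact P h w = 1 - pi w); [ring|lra].
apply: pointwise_dirichlet (hm f) => //.
rewrite hm hw subr0 -[leRHS]mul1r -pi1 mulr_suml.
by apply: ler_sum => v _; rewrite ler_wpM2l.
Qed.

Definition density f := (forall v, 0 <= f v) /\ mean pi f = 1.

Definition admissible P := [/\ transition_matrix P, stationary P pi, reversible P pi & lazy P].

Lemma density_op P f : admissible P -> density f -> density (mxact P f).
Proof.
by move=> [tP sP rP lP] [f0 f1]; split; [exact: op_ge0|rewrite mean_op].
Qed.

Definition variance_pi f := ip pi (fun v => f v - mean pi f) (fun v => f v - mean pi f).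

Lemma variance_pi_density f : \sum_v pi v = 1 -> density f ->
  variance_pi f = ip pi f f - 1.
Proof. by move=> pi1 [_ f1]; rewrite /variance_pi ip_center// f1 mulr1. Qed.

(** The variance drops by at least the Dirichlet form, itself at least [Var^2 / H]; the factor [H]
    is multiplied through to avoid the division. *)
Lemma variance_op_hit P f (H : R) : admissible P -> 0 < H -> (thit P <= H%:E)%E ->
  density f ->
  H * variance_pi (mxact P f) <= H * variance_pi f - variance_pi f ^+ 2.
Proof.
move=> gP H0 hH df; have [tP [pi0 pi1 sp] rP lP] := gP.
have df' := density_op gP df.
rewrite !variance_pi_density//.
have L := lazy_dirichlet f pi0 tP rP lP.
have D : (ip pi f f - 1) ^+ 2 <= H * dirichlet pi P f f.
  apply: variance_dirichlet => //; [exact: df.1|exact: df.2|] => w.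
  exact: hitting_pointwise_dirichlet.
have : 0 <= H * (ip pi f f - dirichlet pi P f f - ip pi (mxact P f) (mxact P f)).
  by rewrite mulr_ge0// ?subr_ge0// ltW.
lra.
Qed.

(** The head of the list acts last, so that the list reads in the order of the matrix product. *)
Definition evolve l f := foldr mxact f l.

Lemma evolve_cat l1 l2 f : evolve (l1 ++ l2) f = evolve l1 (evolve l2 f).
Proof. by rewrite /evolve foldr_cat. Qed.

Lemma evolve_prod l f : evolve l f = mxact (\prod_(A <- l) A) f.
Proof.
elim: l => [|A l IH] /=; first by rewrite big_nil op1.
by rewrite big_cons op_mul IH.
Qed.

(** Moving one self-adjoint matrix at a time across the inner product reverses their order. *)
Lemma evolve_adjoint l f g : (forall A, A \in l -> reversible A pi) ->
  ip pi (evolve (rev l) f) g = ip pi f (evolve l g).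
Proof.
elim: l f g => [//|A l IH] f g rl /=.
rewrite rev_cons -cats1 evolve_cat IH; last by move=> B Bl; apply: rl; rewrite inE Bl orbT.
by rewrite /= op_self_adjoint//; apply: rl; rewrite mem_head.
Qed.

Lemma density_evolve l f : (forall A, A \in l -> admissible A) -> density f ->
  density (evolve l f).
Proof.
elim: l => [//|A l IH] gl df /=; apply: density_op; first by apply: gl; rewrite mem_head.
by apply: IH => // B Bl; apply: gl; rewrite inE Bl orbT.
Qed.

Lemma variance_pi_ge0 f : (forall v, 0 <= pi v) -> 0 <= variance_pi f.
Proof. exact: ip_ge0. Qed.

(** The map [x - x^2] carries the bound [1/n] to [1/(n+1)], through the identity [1 - (n+1)(x - x^2)
    = (1 - n x)(1 - x) + x^2]. *)
Lemma quadratic_recursion (n : nat) (x : R) : 0 <= x -> n%:R * x <= 1 ->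
  n.+1%:R * (x - x ^+ 2) <= 1.
Proof.
move=> x0 nx; rewrite -natr1.
set m : R := n%:R in nx *; have m0 : 0 <= m by rewrite /m.
suff : 0 <= (1 - m * x) * (1 - x) + x ^+ 2 by lra.
case: (lerP x 1) => x1; first by rewrite addr_ge0 ?sqr_ge0// mulr_ge0// subr_ge0.
nra.
Qed.

Lemma variance_evolve_hit l f (H : R) : (forall v, 0 <= pi v) -> 0 < H ->
  (forall A, A \in l -> admissible A) -> (forall A, A \in l -> (thit A <= H%:E)%E) ->
  density f -> (size l)%:R * variance_pi (evolve l f) <= H.
Proof.
move=> pi0 H0; elim: l => [|A l IH] gl hl df; first by rewrite mul0r ltW.
have {}IH : (size l)%:R * variance_pi (evolve l f) <= H.
  by apply: IH => // B Bl; [apply: gl|apply: hl]; rewrite inE Bl orbT.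
have dl : density (evolve l f).
  by apply: density_evolve => // B Bl; apply: gl; rewrite inE Bl orbT.
have := @variance_op_hit A (evolve l f) H (gl A (mem_head _ _)) H0 (hl A (mem_head _ _)) dl.
rewrite /=; set W := variance_pi (mxact A _) => WH.
set U := variance_pi _ in WH IH.
(* Dividing by [H] normalises the one-step inequality to the recursion [x - x^2]. *)
have UH0 : 0 <= U / H by rewrite divr_ge0 ?variance_pi_ge0// ltW.
have {}IH : (size l)%:R * (U / H) <= 1 by rewrite mulrA ler_pdivrMr// mul1r.
have Q := quadratic_recursion UH0 IH.
have : H * ((size l).+1%:R * (U / H - (U / H) ^+ 2)) <= H * 1.
  by rewrite ler_wpM2l// ltW.
rewrite mulr1; apply: le_trans; rewrite mulrCA ler_wpM2l//.
rewrite -(ler_pM2l H0) (le_trans WH)//.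
rewrite le_eqVlt; apply/orP; left; apply/eqP; field; exact: lt0r_neq0.
Qed.

End Decay.

(** * Eigenvalue lists and changes of basis *)

Lemma char_poly_similar (F : comNzRingType) n (X Y B : 'M[F]_n) :
  X *m Y = 1%:M -> char_poly (X *m B *m Y) = char_poly B.
Proof.
move=> XY; rewrite /char_poly.
have XYp : map_mx polyC X *m map_mx polyC Y = 1%:M by rewrite -map_mxM XY map_mx1.
have -> : char_poly_mx (X *m B *m Y) =
    map_mx polyC X *m char_poly_mx B *m map_mx polyC Y.
  rewrite /char_poly_mx mulmxBr mulmxBl -!map_mxM; congr (_ - _).
  by rewrite mul_mx_scalar -scalemxAl XYp scalemx1.
by rewrite !det_mulmx mulrAC -det_mulmx XYp det1 mul1r.
Qed.

Lemma char_poly_diag (F : comNzRingType) n (d : 'rV[F]_n) :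
  char_poly (diag_mx d) = \prod_i ('X - (d 0 i)%:P).
Proof.
rewrite char_poly_trig ?diag_mx_is_trig//.
by apply: eq_bigr => i _; rewrite mxE eqxx.
Qed.

(** Both lists are the roots of one characteristic polynomial, so they agree with multiplicity.
    Multiplicities matter because [lambda_star] removes just one copy of 1. *)
Lemma eigenvalues_similar_diag (R : realType) n (A : 'M[R]_n) (X Y : 'M[R[i]]_n) d :
  X *m Y = 1%:M -> map_mx (real_complex R) A = X *m diag_mx d *m Y ->
  perm_eq (eigenvalues A) [seq d 0 i | i : 'I_n].
Proof.
move=> XY AE; apply: prod_XsubC_eq.
rewrite [RHS]big_map big_enum /= -char_poly_diag -(char_poly_similar _ XY) -AE.
rewrite /eigenvalues; case: closed_field_poly_normal => e /= ->.
by rewrite (monicP (char_poly_monic _)) scale1r.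
Qed.

Section Unitary.
Local Open Scope sesquilinear_scope.

(** Stated for pairs of vectors, since it transports orthogonality to the constants as well as
    norms. *)
Lemma unitary_norm (R : rcfType) n (U : 'M[R[i]]_n) (x y : 'cV[R[i]]_n) :
  U \is unitarymx ->
  \sum_i ((U *m x) i 0)^* * (U *m y) i 0 = \sum_i (x i 0)^* * y i 0.
Proof.
move=> Uu.
have dotE (a b : 'cV[R[i]]_n) : \sum_i (a i 0)^* * b i 0 = (a^t* *m b) 0 0.
  by rewrite mxE; apply: eq_bigr => i _; rewrite !mxE.
rewrite !dotE trmx_mul map_mxM -mulmxA [_ *m (U *m y)]mulmxA.
have /unitarymxP := Uu; move/mulmx1C => ->.
by rewrite mul1mx.
Qed.

End Unitary.

(** * Bounds on the eigenvalues of a transition matrix *)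

Section Spectrum.
Context {R : realType} {V : finType} (P : 'M[R]_#|V|).

Lemma normC_Re (z : R[i]) : (complex.Re `|z|)%:C%C = `|z|.
Proof. by rewrite normc_def. Qed.

Lemma lambda_star_ge0 : 0 <= lambda_star P.
Proof. by rewrite /lambda_star; elim/big_rec: _ => // z x _ x0; rewrite le_max x0 orbT. Qed.

Lemma le_lambda_star z : z \in rem 1 (eigenvalues P) ->
  `|z| <= (lambda_star P)%:C%C.
Proof.
move=> ze; rewrite -normC_Re lecR.
exact: (le_bigmax_seq 0 z xpredT (fun z => complex.Re `|z|)).
Qed.

(* Taking l1-norms in x P = z x gives |z| <= 1. *)
Lemma eigenvalues_le1 z : transition_matrix P -> z \in eigenvalues P -> `|z| <= 1.
Proof.
move=> tP; set Pc := map_mx (real_complex R) P.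
rewrite /eigenvalues; case: closed_field_poly_normal => e /= eE ze.
have : root (char_poly Pc) z.
  by rewrite eE (monicP (char_poly_monic _)) scale1r root_prod_XsubC.
rewrite -eigenvalue_root_char => /eigenvalueP [x xP x0].
have xe j : `|z| * `|x 0 j| <= \sum_i `|x 0 i| * (P i j)%:C%C.
  have := congr1 (fun M : 'rV_#|V| => M 0 j) xP; rewrite !mxE => e1.
  rewrite -normrM -e1; apply: le_trans (ler_norm_sum _ _ _) _.
  apply: ler_sum => i _; rewrite normrM !mxE [`|(P i j)%:C%C|]ger0_norm ?(lecR 0)//.
  have := tP.1 (enum_val i) (enum_val j).
  by rewrite /entry !enum_valK => /andP[].
have P1 i : \sum_j (P i j)%:C%C = 1 :> R[i].
  rewrite -raddf_sum -[X in _ = X]/(1%:C%C); congr (_%:C%C).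
  rewrite -(tP.2 (enum_val i)) (reindex (@enum_rank V)) /=; last first.
    by exists enum_val => j _; [exact: enum_rankK|exact: enum_valK].
  by apply: eq_bigr => v _; rewrite /entry enum_valK.
have L : `|z| * \sum_j `|x 0 j| <= \sum_j `|x 0 j|.
  rewrite mulr_sumr; apply: le_trans (ler_sum _ (fun j _ => xe j)) _.
  rewrite exchange_big /=; apply: ler_sum => i _.
  by rewrite -mulr_sumr P1 mulr1.
move: L; rewrite -[leRHS]mul1r ler_pM2r//.
rewrite lt_def sumr_ge0// andbT; apply: contra x0 => /eqP s0.
apply/eqP/rowP => j; rewrite mxE; apply/eqP; rewrite -normr_eq0; apply/eqP.
by apply: (psumr_eq0P _ s0).
Qed.

Lemma lambda_star_le1 : transition_matrix P -> lambda_star P <= 1.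
Proof.
move=> tP; rewrite /lambda_star big_seq; apply: bigmax_le => // z /mem_rem ze.
by rewrite -lecR normC_Re; apply: eigenvalues_le1.
Qed.

End Spectrum.

(** * Contraction on functions of mean 0 *)

Section SpectralGap.
Context {R : realType} {V : finType} (P : 'M[R]_#|V|) (pi : V -> R).

(** Conjugation by the square roots of [pi] makes [P] real symmetric, hence unitarily
    diagonalizable. In the eigenbasis [P] multiplies each coordinate by an eigenvalue, and a
    function of mean 0 has nonzero coordinates only at eigenvalues that remain after one copy of 1
    is removed. *)
Lemma spectral_gap (f : V -> R) : (forall v, 0 < pi v) -> \sum_v pi v = 1 ->
  transition_matrix P -> reversible P pi -> mean pi f = 0 ->
  ip pi (mxact P f) (mxact P f) <= lambda_star P ^+ 2 * ip pi f f.
Proof.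
move=> pi0 pi1 tP rP f0.
pose n := #|V|.
pose s (i : 'I_n) : R := Num.sqrt (pi (enum_val i)).
have s0 i : 0 < s i by rewrite sqrtr_gt0.
have s2 i : s i ^+ 2 = pi (enum_val i) by rewrite sqr_sqrtr// ltW.
have rPn i j : s i ^+ 2 * P i j = s j ^+ 2 * P j i.
  by have := rP (enum_val i) (enum_val j); rewrite /entry !enum_valK !s2.
pose M : 'M[R[i]]_n := \matrix_(i, j) (s i * P i j / s j)%:C%C.
have Msym : M \is symmetricmx.
  apply/is_hermitianmxP; rewrite scale1r; apply/matrixP => i j; rewrite !mxE.
  congr (_%:C%C); apply/eqP; rewrite eqr_div ?lt0r_neq0//; apply/eqP.
  by have := rPn i j; lra.
have Mreal : M \is a mxOver Num.real.
  by apply/mxOverP => i j; rewrite mxE; apply/complex_realP; eexists.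
have /orthomx_spectralP := symmetric_normalmx Msym Mreal.
set U := spectralmx M; set d := spectral_diag M => ME.
have Uu : U \is unitarymx by exact: spectral_unitarymx.
have Uunit := unitarymx_unit Uu.
have UM : U *m M = diag_mx d *m U by rewrite ME !mulmxA mulmxV// mul1mx.
pose D : 'M[R[i]]_n := diag_mx (\row_i (s i)%:C%C).
pose D' : 'M[R[i]]_n := diag_mx (\row_i (s i)^-1%:C%C).
have DD' : D *m D' = 1%:M.
  apply/matrixP => i j; rewrite mul_diag_mx !mxE.
  case: eqVneq => [->|_]; last by rewrite !mulr0n mulr0.
  by rewrite !mulr1n -rmorphM/= mulfV ?gt_eqF.
(* Undoing the conjugation diagonalizes [P] itself, by [D' *m invmx U] and its inverse [U *m D], so
   that [d] lists the eigenvalues with multiplicity. *)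
have perm : perm_eq (eigenvalues P) [seq d 0 i | i : 'I_n].
  apply: (@eigenvalues_similar_diag _ _ _ (D' *m invmx U) (U *m D)).
    by rewrite mulmxA -(mulmxA D') mulVmx// mulmx1; exact: mulmx1C.
  rewrite -!mulmxA (mulmxA (diag_mx d)) -UM.
  rewrite (mulmxA (invmx U)) (mulmxA (invmx U)) mulVmx// mul1mx.
  apply/matrixP => i j; rewrite mul_diag_mx mul_mx_diag !mxE -!rmorphM/=.
  by congr (_%:C%C); field; rewrite !gt_eqF.
(* Scaling by [s] turns [ip pi] into the standard Hermitian product and the action of [P] into that
   of [M]. *)
pose vec (g : V -> R) : 'cV[R[i]]_n := \col_i (s i * g (enum_val i))%:C%C.
have vecM g : M *m vec g = vec (mxact P g).
  apply/colP => i; rewrite !mxE /mxact mulr_sumr rmorph_sum /=.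
  rewrite (reindex (@enum_rank V)) /=; last first.
    by exists enum_val => j _; [exact: enum_rankK|exact: enum_valK].
  apply: eq_bigr => v _; rewrite !mxE enum_rankK /entry enum_valK -rmorphM /=.
  by congr (_%:C%C); field; rewrite gt_eqF.
have dotvec g h : \sum_i (vec g i 0)^* * vec h i 0 = (ip pi g h)%:C%C.
  rewrite /ip /mean rmorph_sum /= [RHS](reindex (@enum_val V V)) /=; last first.
    by exists enum_rank => j _; [exact: enum_valK|exact: enum_rankK].
  apply: eq_bigr => i _; rewrite !mxE.
  rewrite (_ : ((s i * g (enum_val i))%:C%C)^* = (s i * g (enum_val i))%:C%C).
    by rewrite -rmorphM /= -s2; congr (_%:C%C); ring.
  by apply/CrealP/complex_realP; eexists.
pose x := U *m vec f; pose z := U *m vec (fun=> 1).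
have Ux g i : (U *m vec (mxact P g)) i 0 = d 0 i * (U *m vec g) i 0.
  by rewrite -vecM mulmxA UM -mulmxA mul_diag_mx mxE.
(* [P] fixes the constant 1, so the coordinates [z] of this function are supported on the eigenvalue
   1. *)
have zd i : z i 0 != 0 -> d 0 i = 1.
  move=> zi; have := Ux (fun=> 1) i; rewrite op_cst// -/z => e.
  by apply: (mulIf zi); rewrite -e mul1r.
have zx : \sum_i (z i 0)^* * x i 0 = 0.
  by rewrite unitary_norm// dotvec ipC ip1r f0.
have z0 : exists i, z i 0 != 0.
  apply/existsP; rewrite -negb_forall; apply/negP => /forallP H.
  have := dotvec (fun=> 1) (fun=> 1).
  rewrite ip1r mean1// -(unitary_norm _ _ Uu) big1 => [/eqP|i _].
    by rewrite eq_sym oner_eq0.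
  by rewrite -/z (eqP (H i)) mulr0.
(* If 1 is a simple eigenvalue, then f is orthogonal to its eigenvector; if
   not, then 1 survives the removal of one copy of it. *)
have key i : x i 0 != 0 -> d 0 i \in rem 1 (eigenvalues P).
  move=> xi; apply/negPn/negP => nrem.
  have de : d 0 i \in eigenvalues P.
    by rewrite (perm_mem perm); apply/mapP; exists i; rewrite ?mem_enum.
  have di : d 0 i = 1.
    by apply/eqP/negPn/negP => d1; move: nrem; rewrite rem_mem.
  (* No 1 is left after removing one, yet 1 occurs: it occurs exactly once, and [i] is its only
     index. *)
  have c1 : count_mem (1 : R[i]) (eigenvalues P) = 1%N.
    have := count_mem_rem (1 : R[i]) 1 (eigenvalues P).
    rewrite eqxx; move: nrem de; rewrite di => /count_memPn ->.
    by rewrite -has_pred1 has_count subn1; case: (count _ _) => [|[|k]].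
  have uni j : d 0 j = 1 -> j = i.
    move=> dj; have : (#|[pred k : 'I_n | (d 0 k == 1)%R]| <= 1)%N.
      rewrite cardE /enum_mem size_filter; move: c1.
      rewrite (permP perm) count_map /enum_mem count_filter => /eq_leq.
      by apply: leq_trans; apply: sub_count => k; rewrite /= inE => ->.
    by move/card_le1_eqP; apply; rewrite inE ?dj ?di eqxx.
  have zi : z i 0 != 0 by have [j zj] := z0; rewrite -(uni _ (zd _ zj)).
  (* With [z] supported at [i] alone, orthogonality says that a product of two nonzero factors is
     0. *)
  move: zx; rewrite (bigD1 i)//= big1 ?addr0.
    by move/eqP; rewrite mulf_eq0 conjC_eq0 (negbTE zi) (negbTE xi).
  move=> j ji; have [->|/zd/uni ji'] := eqVneq (z j 0) 0.
    by rewrite rmorph0 mul0r.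
  by rewrite ji' eqxx in ji.
(* Both sides become sums of squared moduli in the eigenbasis, compared coordinate by coordinate. *)
rewrite -lecR rmorphM /= -!dotvec -(unitary_norm (vec f) (vec f) Uu).
rewrite -(unitary_norm (vec (mxact P f)) (vec (mxact P f)) Uu) mulr_sumr.
apply: ler_sum => i _; rewrite Ux -/x.
have [->|xi] := eqVneq (x i 0) 0; first by rewrite !mulr0.
rewrite rmorphM mulrACA ler_wpM2r//; first by rewrite mulrC -normCK exprn_ge0.
rewrite mulrC -normCK rmorphXn /= ler_pXn2r// ?nnegrE ?(lecR 0) ?lambda_star_ge0//.
exact: le_lambda_star (key _ xi).
Qed.
End SpectralGap.

(** * From variance bounds to uniform mixing *)

Section Mixing.
Context {R : realType} {V : finType} (pi : V -> R).
Implicit Types (P : 'M[R]_#|V|) (f g : V -> R) (l : seq 'M[R]_#|V|).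

(** Some state [u] has positive mass, and stationarity under a power of [P] with a positive entry
    from [u] to [v] passes mass on to [v]. *)
Lemma stationary_gt0 P : transition_matrix P -> irreducible P ->
  stationary P pi -> forall v, 0 < pi v.
Proof.
move=> [P01 _] iP [pi0 pi1 sP] v.
have [u u0] : exists u, pi u != 0.
  apply/existsP; rewrite -negb_forall; apply/negP => /forallP H.
  by move: pi1; rewrite big1 => [/eqP|u _]; [rewrite eq_sym oner_eq0|apply/eqP/H].
have [t _ Pt] := iP u v.
have Pt0 w x k : 0 <= entry (P ^+ k) w x.
  elim: k w x => [|k IH] w x; first by rewrite entry1.
  rewrite exprS entry_mul; apply: sumr_ge0 => y _; rewrite mulr_ge0//.
  by have /andP[] := P01 w y.
have -> : pi v = \sum_w pi w * entry (P ^+ t) w v.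
  elim: (t) (v) => [|k IH] x.
    rewrite (bigD1 x)//= entry1 eqxx mulr1 big1 ?addr0// => w wx.
    by rewrite entry1 (negbTE wx) mulr0.
  rewrite exprSr -[LHS]sP.
  under eq_bigr do rewrite IH mulr_suml.
  rewrite exchange_big; apply: eq_bigr => w _.
  by rewrite entry_mul mulr_sumr; apply: eq_bigr => y _; rewrite mulrA.
rewrite (bigD1 u)//= ltr_wpDr//; first by apply: sumr_ge0 => w _; rewrite mulr_ge0.
by rewrite mulr_gt0// lt_def u0 pi0.
Qed.

(** Two distinct states are at least one step apart. This bound later absorbs the rounding of times
    to integers. *)
Lemma thit_ge1 P : (2 <= #|V|)%N -> transition_matrix P -> (thit P < +oo)%E ->
  (1 <= thit P)%E.
Proof.
move=> /card_gt1P[u [w [_ _ uw]]] tP fin.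
apply: le_trans (expected_hit_thit P u w).
have [h1 ->] := expected_hit_fin tP (le_lt_trans (expected_hit_thit P u w) fin).
exact: hit_moment_ge1.
Qed.

(** A finite relaxation time excludes a gap equal to 0, whose inverse is [+oo]; with
    [lambda_star P <= 1] the gap is then positive, and inversion reverses the inequality. *)
Lemma lambda_star_le_trel P (r : R) : transition_matrix P -> (trel P <= r%:E)%E ->
  0 < r /\ lambda_star P <= 1 - r^-1.
Proof.
move=> tP; rewrite /trel inver; case: eqP => // /eqP l1; rewrite lee_fin => lr.
have lt1 : 0 < 1 - lambda_star P by rewrite lt_def l1 subr_ge0 lambda_star_le1.
have r0 : 0 < r by apply: lt_le_trans lr; rewrite invr_gt0.
split=> //; rewrite lerBrDr addrC -lerBrDr.
by rewrite -[leRHS]invrK lef_pV2 // posrE ?invr_gt0.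
Qed.

Lemma variance_op_spectral P f : (forall v, 0 < pi v) -> admissible pi P ->
  variance_pi pi (mxact P f) <= lambda_star P ^+ 2 * variance_pi pi f.
Proof.
move=> pi0 [tP [_ pi1 _] rP _]; rewrite /variance_pi mean_op// -op_center//.
apply: spectral_gap => //.
rewrite /mean; under eq_bigr do rewrite mulrBr.
by rewrite sumrB -mulr_suml pi1 mul1r subrr.
Qed.

Lemma variance_evolve_spectral l f (r : R) : (forall v, 0 < pi v) ->
  (forall A, A \in l -> admissible pi A) -> (forall A, A \in l -> lambda_star A <= r) ->
  variance_pi pi (evolve l f) <= (r ^+ size l) ^+ 2 * variance_pi pi f.
Proof.
move=> pi0; elim: l => [|A l IH] gl rl; first by rewrite expr0 expr1n mul1r.
rewrite /= [r ^+ _]exprS exprMn -mulrA.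
apply: le_trans (variance_op_spectral _ pi0 (gl _ (mem_head _ _))) _.
have Al := rl A (mem_head _ _).
have l0 := lambda_star_ge0 A.
apply: ler_pM; rewrite ?sqr_ge0//.
- by apply: variance_pi_ge0 => v; exact: ltW.
- by rewrite ler_pXn2r// nnegrE// (le_trans l0).
- by apply: IH => B Bl; [apply: gl|apply: rl]; rewrite inE Bl orbT.
Qed.

(** Cauchy-Schwarz, read off from the nonnegativity of [|e f + g|^2] and [|e f - g|^2]. *)
Lemma ip_le f g (e : R) : (forall v, 0 <= pi v) -> 0 < e ->
  ip pi f f <= 1 -> ip pi g g <= e ^+ 2 -> `|ip pi f g| <= e.
Proof.
move=> pi0 e0 ff gg.
have p1 := ip_ge0 (fun v => e * f v + 1 * g v) pi0.
have p2 := ip_ge0 (fun v => e * f v + -1 * g v) pi0.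
move: p1 p2; rewrite !ipDl !ipDr (ipC pi g f).
have eff : e ^+ 2 * ip pi f f <= e ^+ 2 by rewrite ler_piMr// sqr_ge0.
move=> p1 p2; have e2 : 0 < 2 * e by rewrite mulr_gt0.
rewrite ler_norml -(ler_pM2l e2) -[X in _ && X](ler_pM2l e2).
by apply/andP; split; lra.
Qed.

(** The unit mass at [u] as a density relative to [pi]; pairing with it evaluates a function at
    [u]. *)
Definition point_density u : V -> R := fun v => (v == u)%:R / pi u.

Lemma ip_point u f : pi u != 0 -> ip pi (point_density u) f = f u.
Proof.
move=> u0; rewrite /ip /mean (bigD1 u)//= big1 => [|v vu]; last first.
  by rewrite /point_density (negbTE vu) !mul0r mulr0.
by rewrite /point_density eqxx mulr1n; field.
Qed.

Lemma density_point u : 0 < pi u -> density pi (point_density u).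
Proof.
move=> u0; split=> [v|]; first by rewrite /point_density divr_ge0// ltW.
by rewrite -ip1r ip_point// gt_eqF.
Qed.

Lemma evolve_point l u v : evolve l (point_density v) u = entry (\prod_(A <- l) A) u v / pi v.
Proof.
rewrite evolve_prod /mxact (bigD1 v)//= [X in _ + X]big1 => [|w wv]; last first.
  by rewrite /point_density (negbTE wv) !mul0r mulr0.
by rewrite /point_density eqxx mulr1n addr0 mul1r.
Qed.

(* By self-adjointness the first part l1 of the product acts, in reverse order,
   on the starting point u, and l3 on the end point v. *)
Lemma entry_prod_le l1 l2 l3 u v (h r e : R) :
  (forall w, 0 < pi w) ->
  (forall A, A \in l1 ++ l2 ++ l3 -> admissible pi A) ->
  (forall A, A \in l1 ++ l2 ++ l3 -> (thit A <= h%:E)%E) ->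
  (forall A, A \in l1 ++ l2 ++ l3 -> lambda_star A <= r) ->
  0 < h -> h <= (size l1)%:R -> h <= (size l3)%:R ->
  0 <= r -> 0 < e -> r ^+ size l2 <= e -> \sum_w pi w = 1 ->
  `|entry (\prod_(A <- l1 ++ l2 ++ l3) A) u v / pi v - 1| <= e.
Proof.
move=> pi0 gl hl rl h0 h1 h3 r0 e0 re pi1.
have piW w : 0 <= pi w by exact: ltW.
have g1 A : A \in l1 -> admissible pi A by move=> Al; apply: gl; rewrite mem_cat Al.
have g2 A : A \in l2 -> admissible pi A by move=> Al; apply: gl; rewrite !mem_cat Al orbT.
have g3 A : A \in l3 -> admissible pi A by move=> Al; apply: gl; rewrite !mem_cat Al !orbT.
have [du dv] := (density_point (pi0 u), density_point (pi0 v)).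
(* At least [h] steps bring the variance down to [h / h = 1], whatever the starting point. *)
have small l w : h <= (size l)%:R -> (forall A, A \in l -> admissible pi A) ->
    (forall A, A \in l -> (thit A <= h%:E)%E) ->
    variance_pi pi (evolve l (point_density w)) <= 1.
  move=> hs gA hA; have := variance_evolve_hit piW h0 gA hA (density_point (pi0 w)).
  rewrite -[leRHS]mul1r; set W := variance_pi _ _ => Wh.
  rewrite -(ler_pM2l h0) [leRHS]mulrC; apply: le_trans Wh.
  by rewrite ler_wpM2r// variance_pi_ge0.
have gr A : A \in rev l1 -> admissible pi A by rewrite mem_rev; exact: g1.
have da := density_evolve gr du.
have dg := density_evolve g2 (density_evolve g3 dv).
rewrite -evolve_point -ip_point ?gt_eqF// !evolve_cat -evolve_adjoint; last first.
  by move=> A /g1[].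
(* Both densities have mean 1, so subtracting 1 leaves the inner product of the centred functions,
   to which Cauchy-Schwarz applies. *)
have := ip_center (evolve (rev l1) (point_density u))
  (evolve l2 (evolve l3 (point_density v))) pi1.
rewrite da.2 dg.2 mulr1 => <-; apply: ip_le => //.
  have := @small (rev l1) u; rewrite /variance_pi da.2 size_rev; apply => //.
  by move=> A; rewrite mem_rev => Al; apply: hl; rewrite mem_cat Al.
have r2 A : A \in l2 -> lambda_star A <= r by move=> Al; apply: rl; rewrite !mem_cat Al orbT.
(* The middle block multiplies a variance of at most 1 by at most [(r ^+ size l2)^2 <= e^2]. *)
have := variance_evolve_spectral (evolve l3 (point_density v)) pi0 g2 r2.
rewrite {1}/variance_pi dg.2 => L; apply: le_trans L _.
rewrite -[leRHS]mulr1 ler_pM ?sqr_ge0 ?variance_pi_ge0//.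
  by rewrite ler_pXn2r// nnegrE ?exprn_ge0// ltW.
by apply: small => // A Al; apply: hl; rewrite !mem_cat Al !orbT.
Qed.

End Mixing.

(** Uses [1 - x <= exp(-x)] at [x = 1 / rho]; the condition [rho^-1 <= 1] keeps the base
    nonnegative, so that powers preserve the inequality. *)
Lemma exp_decay (R : realType) (rho eps : R) (n : nat) : 0 < rho -> 0 < eps ->
  rho^-1 <= 1 -> rho * ln eps^-1 <= n%:R -> (1 - rho^-1) ^+ n <= eps.
Proof.
move=> rho0 eps0 rho1 ln_le.
apply: (@le_trans _ _ (expR (- rho^-1) ^+ n)).
  rewrite lerXn2r ?nnegrE ?subr_ge0 ?expR_ge0//; exact: expR_ge1Dx.
rewrite -expRM_natl -[leRHS]lnK// ler_expR.
have : rho^-1 * (rho * ln eps^-1) <= rho^-1 * n%:R by rewrite ler_wpM2l// invr_ge0 ltW.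
by rewrite mulKf ?gt_eqF// lnV//; lra.
Qed.

Theorem theorem1p2 (R : realType) :
  exists2 C : R, 0 < C &
  forall (V : finType) (P : nat -> 'M[R]_#|V|) (pi : V -> R),
    (2 <= #|V|)%N ->
    (forall t : nat, (1 <= t)%N ->
       [/\ transition_matrix (P t), irreducible (P t), stationary (P t) pi,
           reversible (P t) pi & lazy (P t)]) ->
    (tHIT P < +oo)%E -> (tREL P < +oo)%E ->
    forall eps : R, 0 < eps < 1 ->
    (tmix_inf P pi eps <= C%:E * (tHIT P + tREL P * (ln eps^-1)%:E))%E.
Proof.
(* Rounding up gives [a <= h + 1] and [b <= rho * ln eps^-1 + 1], so the time [a + b + a] is at most
   [2h + rho * ln eps^-1 + 3]; as [h >= 1], the factor 5 suffices. *)
exists 5 => // V P pi V2 PP finH finR eps /andP[eps0 eps1].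
have hitP t : (1 <= t)%N -> (thit (P t) <= tHIT P)%E.
  by move=> t1; apply: ereal_sup_ubound; exists t.
have relP t : (1 <= t)%N -> (trel (P t) <= tREL P)%E.
  by move=> t1; apply: ereal_sup_ubound; exists t.
have [tP1 iP1 sP1 _ _] := PP 1%N isT.
have [_ pi1 _] := sP1.
have pi0 := stationary_gt0 tP1 iP1 sP1.
have H1 : (1 <= tHIT P)%E.
  apply: le_trans (hitP 1%N isT); apply: thit_ge1 => //.
  exact: le_lt_trans (hitP 1%N isT) finH.
case: (tHIT P) finH hitP H1 => [h| |] // _ hitP; rewrite lee_fin => h1.
have trel0 : (-oo < tREL P)%E.
  apply: lt_le_trans (relP 1%N isT).
  by rewrite /trel inver; case: ifP => // _; rewrite ltNyr.
case: (tREL P) finR relP trel0 => [rho| |] // _ relP _.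
have lamP t : (1 <= t)%N -> 0 < rho /\ lambda_star (P t) <= 1 - rho^-1.
  by move=> t1; apply: lambda_star_le_trel (relP t t1); have [] := PP t t1.
have [rho0 lam1] := lamP 1%N isT.
have r0 : 0 <= 1 - rho^-1 by apply: le_trans lam1; exact: lambda_star_ge0.
have ln0 : 0 <= ln eps^-1 by rewrite ln_ge0// invf_ge1// ltW.
have nat_above (x : R) : 0 <= x -> exists n : nat, x <= n%:R <= x + 1.
  move=> x0; exists (Num.trunc x).+1; have /andP[] := Num.Theory.truncn_itv x0.
  by rewrite -natr1 => a b; lra.
have [a /andP[ha ah]] : exists n : nat, h <= n%:R <= h + 1 by apply: nat_above; lra.
have [b /andP[lb bl]] := nat_above (rho * ln eps^-1) (mulr_ge0 (ltW rho0) ln0).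
rewrite (_ : (_ * _)%E = (5 * (h + rho * ln eps^-1))%:E)//.
apply: (@le_trans _ _ ((a + b + a)%:R%:E)%E); last first.
  rewrite lee_fin !natrD; have := mulr_ge0 (ltW rho0) ln0; lra.
apply: ereal_inf_lbound; exists (a + b + a)%N => //=.
apply: ge_ereal_sup => _ [s [u [v ->]]]; rewrite lee_fin.
(* Indices start at [s.+1], so every matrix in the list is some [P t] with [t >= 1]; the list is
   then cut into blocks of lengths [a], [b] and [a]. *)
pose l := [seq P i | i <- index_iota s.+1 (s + (a + b + a)).+1].
have sl : size l = (a + b + a)%N by rewrite size_map size_iota subSS addKn.
have lE : l = take a l ++ take b (drop a l) ++ drop b (drop a l) by rewrite !cat_take_drop.
have -> : transition_prod P s (a + b + a) =
    \prod_(A <- take a l ++ take b (drop a l) ++ drop b (drop a l)) A.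
  by rewrite -lE big_map.
have lP A : A \in take a l ++ take b (drop a l) ++ drop b (drop a l) ->
    exists2 t, (1 <= t)%N & A = P t.
  rewrite -lE => /mapP[t]; rewrite mem_index_iota => /andP[st _] ->.
  by exists t => //; exact: leq_trans st.
have s1 : size (take a l) = a by rewrite size_takel// sl leq_addl.
have s2 : size (take b (drop a l)) = b by rewrite size_takel// size_drop sl addnK leq_addl.
have s3 : size (drop b (drop a l)) = a by rewrite !size_drop sl !addnK.
apply: (@entry_prod_le _ _ _ _ _ _ _ _ h (1 - rho^-1)); rewrite ?s1 ?s2 ?s3.
- exact: pi0.
- by move=> A /lP[t t1 ->]; have [] := PP t t1.
- by move=> A /lP[t t1 ->]; exact: hitP.
- by move=> A /lP[t t1 ->]; exact: (lamP t t1).2.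
- exact: lt_le_trans h1.
- exact: ha.
- exact: ha.
- exact: r0.
- exact: eps0.
- by apply: exp_decay => //; rewrite -subr_ge0.
- exact: pi1.
Qed.
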